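(* For every pair of positive integers $\ell,r$ with $r\geq 3$, there exists a positive integer $N=N(\ell,r)$ such that for every integer $n\geq N$, $$rx_{3,\ell}(K_{r\times n})=\begin{cases}3 & \text{if } r=3 \text{ and } \ell\in\{1,2,3\},\\ 4 & \text{if } r=3 \text{ and } \ell\geq 4,\\ 3 & \text{if } r\geq 4.\end{cases}$$
   Context: All graphs are undirected, finite and simple. $K_{r\times n}$ is the complete multipartite graph with $r$ vertex classes, each of size $n$. An edge-coloring of a graph $G$ with $t$ colors is any map $c:E(G)\to\{1,\dots,t\}$ (adjacent edges may receive the same color). A tree $T$ that is a subgraph of $G$ is a rainbow tree if no two edges of $T$ have the same color. For $S\subseteq V(G)$, an $S$-tree is a tree in $G$ containing all vertices of $S$, and a rainbow $S$-tree is an $S$-tree that is a rainbow tree. Rainbow $S$-trees $T_1,\dots,T_\ell$ are internally disjoint if $E(T_i)\cap E(T_j)=\emptyset$ and $V(T_i)\cap V(T_j)=S$ for all $1\le i,j\le \ell$ with $i\neq j$. The $(k,\ell)$-rainbow index $rx_{k,\ell}(G)$ is the minimum number of colors needed in an edge-coloring of $G$ such that for every set $S$ of $k$ vertices of $G$ there exist $\ell$ internally disjoint rainbow $S$-trees. *)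

(* Defs.v *)
From mathcomp Require Import all_boot.

Set Implicit Arguments.
Unset Strict Implicit.
Unset Printing Implicit Defensive.

(* Finite simple graphs whose vertices are taken from an ambient finite type,
   so that a graph and its subgraphs have the same type. An edge is the
   two-element set of its ends. *)
Record sgraph (V : finType) := SGraph {
  vertices : {set V};
  edges : {set {set V}};
  edges_axiom : [forall e in edges, (e \subset vertices) && (#|e| == 2)]
}.

Section Graphs.
Variable V : finType.
Implicit Types (G H T : sgraph V) (S : {set V}) (c : {set V} -> nat).

Definition adj G : rel V := [rel x y | [set x; y] \in edges G].

Definition subgraph H G : Prop :=
  vertices H \subset vertices G /\ edges H \subset edges G.

Definition connected G : Prop :=
  vertices G != set0 /\
  {in vertices G &, forall x y, connect (adj G) x y}.

(* Without the lower bound on the size, [::] and a single edge traversed in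
   both directions would count as cycles. *)
Definition acyclic G : Prop :=
  forall p : seq V, 3 <= size p -> uniq p -> ~~ cycle (adj G) p.

Definition is_tree G : Prop := connected G /\ acyclic G.

(* Only the values of c on the edges of G are relevant. *)
Definition edge_coloring G (t : nat) c : Prop :=
  {in edges G, forall e, 1 <= c e <= t}.

Definition rainbow c T : Prop := {in edges T &, injective c}.

Definition rainbow_Stree G c S T : Prop :=
  [/\ subgraph T G, is_tree T, S \subset vertices T & rainbow c T].

Definition internally_disjoint S (l : nat) (T : 'I_l -> sgraph V) : Prop :=
  forall i j : 'I_l, i != j ->
    edges (T i) :&: edges (T j) = set0 /\
    vertices (T i) :&: vertices (T j) = S.

Definition rainbow_colorable G (k l t : nat) : Prop :=
  exists c, edge_coloring G t c /\
    forall S, S \subset vertices G -> #|S| = k ->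
      exists T : 'I_l -> sgraph V,
        (forall i, rainbow_Stree G c S (T i)) /\ internally_disjoint S T.

(* rx_{k,l}(G) = t. A relation rather than a function, because no suitable
   coloring need exist for an arbitrary G. *)
Definition is_rainbow_index G (k l t : nat) : Prop :=
  rainbow_colorable G k l t /\
  forall t', rainbow_colorable G k l t' -> t <= t'.

End Graphs.

Section CompleteMultipartite.
Variables r n : nat.

(* The vertex (i, a) is the a-th vertex of the i-th class. *)
Definition Krn_edges : {set {set 'I_r * 'I_n}} :=
  [set e | [exists u, exists v, (u.1 != v.1) && (e == [set u; v])]].

Lemma Krn_edges_axiom :
  [forall e in Krn_edges, (e \subset [set: 'I_r * 'I_n]) && (#|e| == 2)].
Proof.
apply/forall_inP => e; rewrite inE.
case/existsP => u /existsP[v] /andP[neq_uv /eqP->].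
have neq : u != v by apply: contraNneq neq_uv => ->.
by rewrite subsetT cards2 neq.
Qed.

Definition Krn : sgraph ('I_r * 'I_n)%type := SGraph Krn_edges_axiom.

End CompleteMultipartite.

(* Main.v *)
Require Import Defs.
From mathcomp Require Import all_boot zify.

(* Upper bound: by counting, for n large some t-coloring of all pairs of
   vertices has the property that any three vertices see any prescribed triple
   of colors at a vertex of any prescribed class outside any bounded set, so the
   trees for S can be picked one after the other. If some class misses S, they
   are stars centered in that class. Otherwise r = 3 and S = {u, v, x} is a
   transversal; with three colors the paths u - v - w - x, with w in the class
   of u, and their two rotations give three trees, and with four colors any
   number of trees with edges wv, wx, ww', w'u is available, where w and w' are
   in the classes of u and v.
   Lower bound: three vertices of one class have disjoint incident edges, so
   three colors are needed. In K_{3 x n} a tree with at most three edges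
   containing a transversal S uses one of the three edges inside S, which
   leaves room for only three edge-disjoint trees. *)

Set Implicit Arguments.
Unset Strict Implicit.
Unset Printing Implicit Defensive.

(** * Growth estimates: an exponential with ratio above one beats any polynomial *)

(** Induction on the degree by halving [j]: of the two factors in [2 ^ j./2 * 2 ^ j./2], one absorbs
    a polynomial of degree one less and the other absorbs the remaining linear factor. *)
Lemma polynomial_ltn_exp2 (C d : nat) :
  exists J, forall j, J <= j -> C * j.+1 ^ d < 2 ^ j.
Proof.
elim: d C => [|d IHd] C.
  exists C => j leCj; rewrite expn0 muln1.
  exact: leq_ltn_trans leCj (ltn_expl _ _).
(* The factor [2 ^ d.+1] pays for replacing [j.+1] by [2 * (j./2).+1]. *)
have [J HJ] := IHd (C * 2 ^ d.+1); exists J.*2 => j leJj.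
have leJi : J <= j./2 by lia.
have /HJ ltC := leJi.
apply: (@leq_ltn_trans (C * (2 * (j./2).+1) ^ d.+1)).
  by rewrite leq_mul2l leq_exp2r //; apply/orP; right; lia.
apply: (@leq_trans (2 ^ j./2 * 2 ^ j./2)); last first.
  by rewrite -expnD leq_exp2l //; lia.
rewrite expnMn (expnSr (j./2).+1) !mulnA.
apply: (@leq_trans ((C * 2 ^ d.+1 * (j./2).+1 ^ d).+1 * (j./2).+1)).
  by rewrite ltn_pmul2r.
by apply: leq_mul => //; apply: ltn_expl.
Qed.

(** Bernoulli's inequality cleared of denominators: the first two terms of the binomial
    expansion. *)
Lemma bernoulli_expn (a k : nat) : a ^ k.+1 + k.+1 * a ^ k <= a.+1 ^ k.+1.
Proof.
elim: k => [|k IHk]; first by rewrite !expn1 expn0 addn1.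
rewrite (expnS a.+1); apply: leq_trans (leq_mul (leqnn a.+1) IHk).
by rewrite !expnS; nia.
Qed.

(** For positive [a], each block of [a] exponents at least doubles the ratio of the two powers, by
    Bernoulli. With [j] full blocks in [m] this gains [2 ^ j], while the polynomial in [m] is at
    most a polynomial in [j]. *)
Lemma polynomial_ltn_exp_ratio (a C d e : nat) :
  exists N, forall m, N <= m -> C * (m + e) ^ d * a ^ m < a.+1 ^ m.
Proof.
(* For base 0 the left side vanishes once [m] is positive. *)
case: a => [|a]; first by exists 1 => -[|m] // _; rewrite exp0n // muln0 exp1n.
have [J HJ] := polynomial_ltn_exp2 (C * (a.+1 + e) ^ d) d.
exists (a.+1 * J) => m lem.
pose j := m %/ a.+1.
have leJj : J <= j by rewrite leq_divRL // mulnC.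
have le_jm : a.+1 * j <= m by rewrite mulnC leq_divM.
have lt_mj : m < a.+1 * j.+1 by rewrite mulnC ltn_ceil.
have two : 2 * a.+1 ^ a.+1 <= a.+2 ^ a.+1.
  by have := bernoulli_expn a.+1 a; rewrite -expnS mul2n addnn.
apply: (@leq_trans (2 ^ j * a.+1 ^ m)).
  rewrite ltn_pmul2r ?expn_gt0 //; apply: leq_ltn_trans (HJ _ leJj).
  rewrite -mulnA -expnMn leq_mul2l; apply/orP; right.
  by case: (d) => // d'; rewrite leq_exp2r //; nia.
have leq_exp x y k : x <= y -> x ^ k <= y ^ k.
  by case: k => // k; rewrite leq_exp2r.
rewrite -(subnKC le_jm) (expnD a.+1) (expnD a.+2) mulnA.
apply: leq_mul; last exact: leq_exp.
by rewrite (expnM a.+1) (expnM a.+2) -expnMn; apply: leq_exp.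
Qed.

(** * Counting the colorings that avoid a color pattern on stars *)

Section StarPatterns.
Variables (V : finType) (t d : nat).
Implicit Types (s : d.-tuple V) (p : d.-tuple 'I_t) (w : V) (ws : seq V).
Implicit Types (g h : {ffun {set V} -> 'I_t}).

Definition star_pattern s p g w :=
  [forall i, g [set tnth s i; w] == tnth p i].

(** Overwriting a star serves both to plant the pattern at [w] and to restore the old colors
    afterwards; the count below rests on this reversibility. *)
Definition recolor_star s w p g : {ffun {set V} -> 'I_t} :=
  [ffun e => if [pick i | e == [set tnth s i; w]] is Some i then tnth p i
             else g e].

Lemma recolor_star_in s w p g i :
  uniq s -> w \notin s -> recolor_star s w p g [set tnth s i; w] = tnth p i.
Proof.
move=> us ws; rewrite ffunE; case: pickP => [j /eqP eq_ij|/(_ i)]; last first.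
  by rewrite eqxx.
have: tnth s i \in [set tnth s j; w] by rewrite -eq_ij set21.
rewrite in_set2 => /orP[|/eqP eq_w]; last by rewrite -eq_w mem_tnth in ws.
by move=> /eqP /tuple_uniqP -> .
Qed.

Lemma recolor_star_out s w p g i w' :
    w \notin s -> w' \notin s -> w' != w ->
  recolor_star s w p g [set tnth s i; w'] = g [set tnth s i; w'].
Proof.
move=> ws ws' neq; rewrite ffunE; case: pickP => // j /eqP eq_ij.
have: w' \in [set tnth s j; w] by rewrite -eq_ij set22.
rewrite in_set2 (negPf neq) orbF => /eqP eq_w'.
by rewrite eq_w' mem_tnth in ws'.
Qed.

Definition star_free s p ws : {set {ffun {set V} -> 'I_t}} :=
  [set g | all (fun w => ~~ star_pattern s p g w) ws].

(* Recoloring the star at a new vertex [w] does not affect the other stars, so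
   the pattern occurs at [w] in at least one in [t ^ d] of the colorings. *)
Lemma card_star_free s p ws :
    uniq s -> uniq ws -> {in ws, forall w, w \notin s} ->
  #|star_free s p ws| * (t ^ d) ^ size ws
    <= (t ^ d).-1 ^ size ws * #|{ffun {set V} -> 'I_t}|.
Proof.
move=> us; elim: ws => [|w ws IH] /= => [_ _|/andP[w_ws uws] ws_s].
  by rewrite !expn0 muln1 mul1n max_card.
have w_s : w \notin s by apply: ws_s; rewrite mem_head.
have ws_s' : {in ws, forall w, w \notin s}.
  by move=> w' w'ws; apply: ws_s; rewrite in_cons w'ws orbT.
have {}IH := IH uws ws_s'.
pose Good := star_free s p ws :&: [set g | star_pattern s p g w].
have cardD : #|star_free s p ws| = #|Good| + #|star_free s p (w :: ws)|.
  rewrite -(cardsID [set g | star_pattern s p g w]); congr addn.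
  by apply: eq_card => g; rewrite !inE /= andbC.
have le_good : #|star_free s p ws| <= #|Good| * t ^ d.
  have -> : #|Good| * t ^ d = #|setX Good [set: d.-tuple 'I_t]|.
    by rewrite cardsX cardsT card_tuple card_ord.
  (* [F] writes [d] given colors back onto the star at [w]. Every member of [star_free s p ws] is
     hit: plant the pattern at [w], and remember the colors that it replaced. *)
  pose F (x : {ffun {set V} -> 'I_t} * d.-tuple 'I_t) :=
    recolor_star s w x.2 x.1.
  apply: leq_trans (leq_imset_card F _); apply: subset_leq_card.
  apply/subsetP => h h_free; apply/imsetP.
  exists (recolor_star s w p h, [tuple h [set tnth s i; w] | i < d]).
    rewrite !inE andbT; apply/andP; split.
      move: h_free; rewrite inE => /allP h_free; apply/allP => w' w'ws.
      apply: contra (h_free _ w'ws) => /forallP pat; apply/forallP => i.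
      have neq : w' != w by apply: contraNneq w_ws => <-.
      by rewrite -(eqP (pat i)) recolor_star_out // ws_s'.
    by apply/forallP => i; rewrite recolor_star_in.
  apply/ffunP => e; rewrite ffunE; case: pickP => [i /eqP ->|out_e].
    by rewrite tnth_mktuple.
  rewrite ffunE; case: pickP => // i; by rewrite out_e.
rewrite !expnS.
move: IH cardD le_good; set B' := #|star_free s p ws|.
set B := #|star_free s p (w :: ws)|; set G := #|Good|; set K := t ^ d.
set A := #|{ffun _ -> _}|; set X := K ^ _; set Y := _ ^ _ => IH cardD le_good.
(* From [B' = G + B] and [B' <= G * K]: at most the fraction [(K - 1) / K] of the colorings survives
   each further center. *)
have step : B * K <= K.-1 * B' by nia.
by apply: (@leq_trans (K.-1 * B' * X)); nia.
Qed.

End StarPatterns.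

(** * A coloring in which all star patterns occur *)

(** The union bound, with the bound [Y / X] for a single event cleared of its denominator. *)
Lemma card_exists_le (E G : finType) (P : E -> pred G) (X Y : nat) :
    (forall x, #|[set g | P x g]| * X <= Y) ->
  #|[set g | [exists x, P x g]]| * X <= #|E| * Y.
Proof.
move=> leXY; have -> : [set g | [exists x, P x g]] = \bigcup_x [set g | P x g].
  apply/setP => g; rewrite inE; apply/existsP/bigcupP => -[x].
    by exists x; rewrite ?inE.
  by rewrite inE; exists x.
apply: (@leq_trans (\sum_(x : E) Y)); last by rewrite sum_nat_const.
apply: leq_trans (_ : \sum_x #|[set g | P x g]| * X <= _); last exact: leq_sum.
rewrite -big_distrl leq_mul2r; apply/orP; right => /=.
elim/big_ind2: _ => // [|A m B k leA leB]; first by rewrite cards0.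
by apply: leq_trans (leq_card_setU _ _) _; rewrite leq_add.
Qed.

(** A bad event consists of leaves, prescribed colors, a class and forbidden vertices for which no
    admissible center shows the pattern. There are polynomially many events in [n], and each has an
    exponentially small share of the colorings. *)
Lemma exists_star_coloring (r t d L : nat) : 0 < t ->
  exists N, forall n, N <= n -> exists c : {set 'I_r * 'I_n} -> nat,
    (forall e, 1 <= c e <= t) /\
    forall (s : d.-tuple ('I_r * 'I_n)) (p : d.-tuple nat) (k : 'I_r)
        (F : {set 'I_r * 'I_n}),
      uniq s -> all (fun q => 1 <= q <= t) p -> #|F| <= L ->
      exists w, [/\ w.1 = k, w \notin F &
                  forall i, c [set tnth s i; w] = tnth p i].
Proof.
move=> t_gt0.
(* The coefficient times [n ^ (d + L)] is the number of events. At least [m = n - (d + L)] centers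
   remain in a class after removing the leaves and the forbidden vertices. *)
have [N HN] := polynomial_ltn_exp_ratio (t ^ d).-1
  (r ^ d * t ^ d * r * r ^ L) (d + L) (d + L).
exists (N + (d + L)).+1 => n leNn; pose m := n - (d + L).
have n_gt0 : 0 < n by lia.
have /HN {HN} : N <= m by lia.
rewrite subnK; last by lia.
rewrite prednK ?expn_gt0 ?t_gt0 // => ltm.
pose V := ('I_r * 'I_n)%type.
pose Ev := (d.-tuple V * d.-tuple 'I_t * 'I_r * L.-tuple V)%type.
pose candidates (ev : Ev) :=
  [seq w <- enum {: V} | [&& w.1 == ev.1.2, w \notin ev.1.1.1 & w \notin ev.2]].
pose P (ev : Ev) (g : {ffun {set V} -> 'I_t}) := uniq ev.1.1.1 &&
  all (fun w => ~~ star_pattern ev.1.1.1 ev.1.1.2 g w) (candidates ev).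
have size_candidates ev : m <= size (candidates ev).
  case: ev => [[[s p] k] F]; rewrite /candidates /=.
  set ws := filter _ _.
  have card_k : #|[set (k, a) | a : 'I_n]| = n.
    by rewrite card_imset ?card_ord // => a b [].
  have sub : [set (k, a) | a : 'I_n] \subset ws ++ s ++ F.
    apply/subsetP => _ /imsetP[a _ ->]; rewrite !mem_cat mem_filter mem_enum /=.
    by rewrite eqxx !andbT; case: (_ \in s); case: (_ \in F).
  have := leq_trans (subset_leq_card sub) (card_size _).
  by rewrite card_k !size_cat !size_tuple /m; move: (size ws) => z; lia.
have card_P ev :
    #|[set g | P ev g]| * (t ^ d) ^ m
      <= (t ^ d).-1 ^ m * #|{ffun {set V} -> 'I_t}|.
  case us: (uniq ev.1.1.1); last first.
    rewrite (_ : [set g | P ev g] = set0) ?cards0 //.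
    by apply/setP => g; rewrite !inE /P us.
  pose ws := take m (candidates ev).
  have size_ws : size ws = m by rewrite size_takel.
  have uws : uniq ws by rewrite take_uniq // filter_uniq // enum_uniq.
  have ws_s : {in ws, forall w, w \notin ev.1.1.1}.
    by move=> w /mem_take; rewrite mem_filter => /andP[/and3P[]].
  have := card_star_free ev.1.1.2 us uws ws_s; rewrite size_ws.
  apply: leq_trans; rewrite leq_mul2r; apply/orP; right.
  apply: subset_leq_card; apply/subsetP => g; rewrite !inE => /andP[_].
  by move=> /allP free; apply/allP => w /mem_take; apply: free.
have card_bad := card_exists_le card_P.
have [g g_good] : exists g, ~~ [exists ev, P ev g].
  apply/existsP; rewrite -negb_forall; apply/negP => /forallP all_bad.
  move: card_bad; rewrite (_ : [set g | _] = setT); last first.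
    by apply/setP => g; rewrite !inE all_bad.
  have tot_gt0 : 0 < #|{ffun {set V} -> 'I_t}|.
    by rewrite card_ffun card_ord expn_gt0 t_gt0.
  rewrite cardsT mulnC mulnA leq_pmul2r //.
  rewrite !card_prod !card_tuple !card_prod !card_ord leqNgt.
  move: ltm; rewrite expnD.
  rewrite !expnMn => ltm /negP[]; apply: leq_trans ltm.
  by rewrite ltnS; apply: eq_leq; lia.
(* The shift turns the colors [0, ..., t - 1] of ['I_t] into [1, ..., t]. *)
exists (fun e => (g e).+1); split=> [e|s p k F us allp leF] /=.
  exact: ltn_ord.
pose v0 : V := (k, Ordinal n_gt0).
(* Events list exactly [L] forbidden vertices, so [F] is padded with copies of [v0]; forbidding one
   more vertex does no harm. *)
pose s' : seq V := enum F ++ nseq (L - #|F|) v0.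
have sz : size s' == L by rewrite size_cat size_nseq -cardE subnKC.
pose p' : d.-tuple 'I_t := [tuple insubd (Ordinal t_gt0) (tnth p i).-1 | i < d].
have := g_good; rewrite negb_exists => /forallP/(_ (s, p', k, Tuple sz)).
rewrite /P us /= => /allPn[w]; rewrite mem_filter /= =>
  /andP[/and3P[/eqP wk _ wF] _].
rewrite negbK => /forallP pat; exists w; split=> // [|i].
  by apply: contra wF => wF; rewrite mem_cat mem_enum wF.
rewrite (eqP (pat i)) tnth_mktuple val_insubd.
have /(allP allp)/andP[? ?] := mem_tnth i p.
by rewrite prednK // ifT // prednK.
Qed.

(** * Building trees vertex by vertex, and choosing disjoint ones greedily *)

Section Trees.
Variable V : finType.
Implicit Types (G T : sgraph V) (c : {set V} -> nat) (S F e : {set V}).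
Implicit Types (x y z : V) (ps : seq (V * V)).

Lemma edge_vertices G e : e \in edges G -> e \subset vertices G.
Proof. by move=> eG; have /forall_inP/(_ e eG)/andP[] := edges_axiom G. Qed.

Lemma adj_sym G : symmetric (adj G).
Proof. by move=> x y; rewrite /adj /= setUC. Qed.

Lemma adj_vertices G x y : adj G x y ->
  (x \in vertices G) && (y \in vertices G).
Proof. by move/edge_vertices; rewrite subUset !sub1set. Qed.

Lemma adj_neq G x y : adj G x y -> x != y.
Proof.
move=> xy; have /forall_inP/(_ _ xy)/andP[_] := edges_axiom G.
by apply: contraTneq => ->; rewrite setUid cards1.
Qed.

Lemma connected_incident G x y :
    connected G -> x \in vertices G -> y \in vertices G -> x != y ->
  exists z, adj G x z.
Proof.
move=> [_ conn] xG yG neq; have /connectP[[|z p] /=] := conn _ _ xG yG.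
  by move=> _ eq_xy; rewrite eq_xy eqxx in neq.
by case/andP; exists z.
Qed.

Lemma empty_sgraph_axiom :
  [forall e in (set0 : {set {set V}}),
    (e \subset (set0 : {set V})) && (#|e| == 2)].
Proof. by apply/forall_inP => e; rewrite inE. Qed.

Lemma singleton_tree x :
  exists T, [/\ is_tree T, vertices T = [set x] & edges T = set0].
Proof.
have ax : [forall e in (set0 : {set {set V}}),
  (e \subset [set x]) && (#|e| == 2)].
  by apply/forall_inP => e; rewrite inE.
exists (SGraph ax); split=> //; split; first split=> /=.
- by apply/set0Pn; exists x; rewrite set11.
- by move=> y z /set1P-> /set1P->.
by move=> [|y [|z p]] //= _ _; apply/negP => /andP[]; rewrite /adj /= inE.
Qed.

(** A cycle through [y] would need two distinct neighbors of [y], but [x] is the only one; a cycle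
    avoiding [y] already lies in [T]. *)
Lemma pendant_tree T x y :
    is_tree T -> x \in vertices T -> y \notin vertices T ->
  exists T', [/\ is_tree T', vertices T' = y |: vertices T &
                 edges T' = [set y; x] |: edges T].
Proof.
move=> [[nonempty conn] acyc] xT yT.
have neq_yx : y != x by apply: contraNneq yT => ->.
have ax : [forall e in [set y; x] |: edges T,
             (e \subset y |: vertices T) && (#|e| == 2)].
  apply/forall_inP => e /setU1P[->|eT].
    by rewrite subUset !sub1set !inE eqxx xT orbT cards2 neq_yx.
  have /forall_inP/(_ e eT)/andP[sub ->] := edges_axiom T.
  by rewrite (subset_trans sub) // subsetUr.
exists (SGraph ax); split=> //; set T' := SGraph ax.
have adjE u v : adj T' u v = ([set u; v] == [set y; x]) || adj T u v.
  by rewrite /adj /= !inE.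
have adj_y v : adj T' y v -> v = x.
  rewrite adjE => /orP[/eqP eq_yv|/adj_vertices]; last by rewrite (negPf yT).
  have: v \in [set y; x] by rewrite -eq_yv set22.
  rewrite !inE => /orP[/eqP eq_vy|/eqP //].
  have: x \in [set y; v] by rewrite eq_yv set22.
  by rewrite !inE eq_vy orbb eq_sym (negPf neq_yx).
split; first split=> /=.
- by apply/set0Pn; exists y; rewrite setU11.
- have toX u : u \in y |: vertices T -> connect (adj T') u x.
    case/setU1P=> [->|uT]; first by rewrite connect1 // adjE eqxx.
    apply: connect_sub (conn _ _ uT xT) => a b ab.
    by rewrite connect1 // adjE ab orbT.
  move=> u v uT vT; apply: connect_trans (toX u uT) _.
  by rewrite (sym_connect_sym (@adj_sym T')) toX.
move=> p size_p uniq_p; apply/negP => cyc_p.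
have [yp|yp] := boolP (y \in p).
  case/rot_to: yp => i q rot_q.
  have: cycle (adj T') (y :: q) by rewrite -rot_q rot_cycle.
  have: uniq (y :: q) by rewrite -rot_q rot_uniq.
  have: 3 <= size (y :: q) by rewrite -rot_q size_rot.
  case: q {rot_q} => [|a [|b q]] // _ /= /and3P[_ a_q _] /andP[ya].
  case/andP=> _; rewrite rcons_path => /andP[_]; rewrite adj_sym => /adj_y eq_x.
  by rewrite (adj_y _ ya) -eq_x mem_last in a_q.
move/negP: (acyc p size_p uniq_p); apply.
have eq_adj : {in mem p &, adj T' =2 adj T}.
  move=> u v up vp; rewrite adjE orb_idl // => /eqP eq_uv.
  have: y \in [set u; v] by rewrite eq_uv set21.
  by rewrite !inE => /orP[] /eqP eq_y; rewrite eq_y ?up ?vp in yp.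
by rewrite -(eq_in_cycle eq_adj) //; apply/allP.
Qed.

(* [ps] lists pairs (child, parent) that are added to the root [x] from right to
   left. *)
Fixpoint grown x ps : bool :=
  if ps is p :: ps' then
    [&& grown x ps', p.1 \notin x :: unzip1 ps' & p.2 \in x :: unzip1 ps']
  else true.

Lemma grown_tree x ps : grown x ps ->
  exists T, [/\ is_tree T, vertices T = [set y in x :: unzip1 ps] &
                edges T = [set e in [seq [set p.1; p.2] | p <- ps]]].
Proof.
elim: ps => [|[y z] ps IH] /=.
  have [T [? vT eT]] := singleton_tree x; exists T; split=> //.
    by rewrite vT; apply/setP => y; rewrite !inE.
case/and3P=> /IH[T [tT vT eT]] y_new z_old.
have zT : z \in vertices T by rewrite vT inE.
have yT : y \notin vertices T by rewrite vT inE.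
have [T' [tT' vT' eT']] := pendant_tree tT zT yT.
exists T'; split=> //.
  by rewrite vT' vT; apply/setP => u; rewrite !inE orbCA.
by rewrite eT' eT; apply/setP => e; rewrite !inE.
Qed.

(* [P i] holds of the edges inside [S] that are reserved for the i-th tree. *)
Lemma greedy_internally_disjoint G c S (l b : nat)
    (P : nat -> {set V} -> Prop) :
    (forall i j e, P i e -> P j e -> i = j) ->
    (forall i F, i < l -> #|F| <= b * l -> exists T,
       [/\ rainbow_Stree G c S T, #|vertices T| <= b,
           vertices T :&: F \subset S &
           forall e, e \in edges T -> e \subset S -> P i e]) ->
  exists T : 'I_l -> sgraph V,
    (forall i, rainbow_Stree G c S (T i)) /\ internally_disjoint S T.
Proof.
move=> injP step.
(* [F] accumulates the vertices of the trees chosen so far, and each new tree meets [F] only inside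
   [S]. *)
have [T [F [leF good disj]]] : exists (T : nat -> sgraph V) F,
    [/\ #|F| <= b * l,
        forall i, i < l -> [/\ rainbow_Stree G c S (T i),
          vertices (T i) \subset F &
          forall e, e \in edges (T i) -> e \subset S -> P i e] &
        forall i j, i < j < l -> vertices (T i) :&: vertices (T j) \subset S].
  have: l <= l by []; elim: {1 3 4 5}l => [|m IH] lt_ml.
    (* The empty graph is a placeholder at indices not yet treated. *)
    exists (fun=> SGraph empty_sgraph_axiom), set0.
    by rewrite cards0; split=> // i j; rewrite andbF.
  have [T [F [leF good disj]]] := IH (ltnW lt_ml).
  have leF' : #|F| <= b * l.
    by apply: leq_trans leF _; rewrite leq_mul2l (ltnW lt_ml) orbT.
  have [Tm [rTm cTm dTm PTm]] := step m F lt_ml leF'.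
  exists (fun i => if i == m then Tm else T i), (vertices Tm :|: F); split.
  - apply: leq_trans (leq_card_setU _ _) _; lia.
  - move=> i; rewrite ltnS leq_eqVlt; case: eqP => [-> _|_ /= lt_im].
      by split=> //; apply: subsetUl.
    have [? sub ?] := good i lt_im; split=> //.
    exact: subset_trans sub (subsetUr _ _).
  move=> i j /andP[lt_ij]; rewrite ltnS leq_eqVlt.
  case: eqP => [eq_jm _|_ /= lt_jm].
    rewrite ltn_eqF -?eq_jm //; have [_ sub _] := good i ltac:(lia).
    by apply: subset_trans dTm; rewrite setIC; apply: setIS.
  by rewrite ltn_eqF ?disj ?lt_ij //; lia.
exists (fun i => T i); split=> [i|i j neq_ij];
  first by have [] := good i (ltn_ord i).
have sub : vertices (T i) :&: vertices (T j) \subset S.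
  have [lt|lt|/val_inj eq_ij] := ltngtP i j.
  - by apply: disj; rewrite lt ltn_ord.
  - by rewrite setIC; apply: disj; rewrite lt ltn_ord.
  - by rewrite eq_ij eqxx in neq_ij.
have [[_ _ Si _] _ Pi] := good i (ltn_ord i).
have [[_ _ Sj _] _ Pj] := good j (ltn_ord j).
split; last by apply/eqP; rewrite eqEsubset sub subsetI Si Sj.
apply/setP => e; rewrite !inE; apply/negP => /andP[ei ej].
(* A common edge joins common vertices, so it lies inside [S] and would be reserved for both
   trees. *)
have eS : e \subset S.
  by apply: subset_trans sub; rewrite subsetI !edge_vertices.
by move/eqP: neq_ij; apply; apply: val_inj;
  apply: injP (Pi e ei eS) (Pj e ej eS).
Qed.

End Trees.

(** * Rainbow trees in the complete multipartite graph *)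

Lemma map_uniq_inj_in (A B : eqType) (f : A -> B) (s : seq A) :
  uniq (map f s) -> {in s &, injective f}.
Proof.
elim: s => //= a s IH /andP[fa_s /IH inj_s] x y; rewrite !in_cons.
case/predU1P=> [->|xs]; case/predU1P=> [->|ys] // eq_f; last exact: inj_s.
  by rewrite eq_f map_f in fa_s.
by rewrite -eq_f map_f in fa_s.
Qed.

Lemma mem_Krn_edges r n (u v : 'I_r * 'I_n) :
  ([set u; v] \in edges (Krn r n)) = (u.1 != v.1).
Proof.
rewrite inE; apply/existsP/idP => [[a /existsP[b /andP[neq /eqP eq_ab]]]|neq].
  have ua : u \in [set a; b] by rewrite -eq_ab set21.
  have va : v \in [set a; b] by rewrite -eq_ab set22.
  have au : a \in [set u; v] by rewrite eq_ab set21.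
  have bu : b \in [set u; v] by rewrite eq_ab set22.
  move: au bu neq; case/set2P: ua => ->; case/set2P: va => -> //.
  - by move=> _ /set2P[]->; rewrite eqxx.
  - by rewrite eq_sym.
  - by move=> /set2P[]->; rewrite eqxx.
by exists u; apply/existsP; exists v; rewrite neq eqxx.
Qed.

(** For an explicit list of (child, parent) pairs, the defining properties of a rainbow tree
    containing [S] become conditions checked by computation. *)
Lemma grown_rainbow_Stree r n c (S : {set 'I_r * 'I_n}) x ps :
    grown x ps -> all (fun p => p.1.1 != p.2.1) ps ->
    uniq [seq c [set p.1; p.2] | p <- ps] -> S \subset x :: unzip1 ps ->
  exists T, [/\ rainbow_Stree (Krn r n) c S T,
                vertices T = [set y in x :: unzip1 ps] &
                edges T = [set e in [seq [set p.1; p.2] | p <- ps]]].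
Proof.
move=> /grown_tree[T [tT vT eT]] /allP cls uc sub; exists T; split=> //;
  split=> //.
- split; first exact: subsetT.
  rewrite eT; apply/subsetP => e; rewrite inE => /mapP[p /cls neq ->].
  by rewrite mem_Krn_edges.
- by rewrite vT; apply/subsetP => y /(subsetP sub); rewrite in_set.
rewrite /rainbow eT => e f; rewrite !in_set =>
  /mapP[p pp ->] /mapP[q qq ->] eq_c.
by rewrite (map_uniq_inj_in uc pp qq eq_c).
Qed.

Section Extendable.
Variables r n : nat.
Local Notation V := ('I_r * 'I_n)%type.
Implicit Types (u v x w : V) (c : {set V} -> nat) (F S : {set V}).

(** The star property for three leaves. Colors are prescribed on all pairs, so [k] may be the class
    of a leaf, and the color of that non-edge is then a dummy. The center may be a leaf unless [F]
    or its class excludes this. *)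
Definition extends_stars c (t L : nat) : Prop :=
  forall u v x (k : 'I_r) (p q s : nat) F,
    uniq [:: u; v; x] -> all (fun j => 1 <= j <= t) [:: p; q; s] -> #|F| <= L ->
    exists w, [/\ w.1 = k, w \notin F,
      c [set u; w] = p, c [set v; w] = q & c [set x; w] = s].

Lemma extendable_outer_class c t l u v x (k : 'I_r) :
    3 <= t -> extends_stars c t (5 * l + 5) -> uniq [:: u; v; x] ->
    k \notin [:: u.1; v.1; x.1] ->
  exists T : 'I_l -> sgraph V,
    (forall i, rainbow_Stree (Krn r n) c [set y in [:: u; v; x]] (T i)) /\
    internally_disjoint [set y in [:: u; v; x]] T.
Proof.
move=> t_ge3 ext uvx kS.
(* Every edge of a star contains its center outside [S], so no edge inside [S] has to be reserved.
   The bound 5 is common to all tree shapes. *)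
apply: (@greedy_internally_disjoint _ _ _ _ _ 5 (fun _ _ => False)) => //.
move=> _ F _ leF.
have [||w [wk wF cu cv cx]] := ext u v x k 1 2 3 F uvx;
  [by rewrite /=; lia|lia|].
have wS : w \notin [:: u; v; x].
  apply: contra kS; rewrite -wk; exact: (map_f (fun y : V => y.1)).
have neq_w y : y \in [:: u; v; x] -> y.1 != w.1.
  move=> /(map_f (fun z : V => z.1)) /= yS.
  by apply: contraNneq kS => eq_y; rewrite -wk -eq_y.
pose ps := [:: (u, w); (v, w); (x, w)].
have [||||T [rT vT eT]] :=
  @grown_rainbow_Stree r n c [set y in [:: u; v; x]] w ps.
- move: uvx wS; rewrite /ps /= !inE !eqxx !negb_or ?orbT !andbT !(eq_sym w).
  by move=> /andP[/andP[-> ->] ->] /and3P[-> -> ->].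
- by rewrite /= !neq_w ?inE ?eqxx ?orbT.
- by rewrite /= cu cv cx.
- by apply/subsetP => y; rewrite !inE => ->; rewrite orbT.
exists T; split=> //.
- rewrite vT cardsE; exact: leq_trans (card_size _) _.
- apply/subsetP => y; rewrite vT !inE; case: eqP => [->|] /=;
    last by move=> _ /andP[].
  by rewrite (negPf wF).
move=> e; rewrite eT inE => /mapP[p pps ->];
  rewrite subUset !sub1set => /andP[_].
have -> : p.2 = w by move: pps; rewrite /ps !inE => /or3P[]/eqP->.
by rewrite inE (negPf wS).
Qed.

Lemma extendable_transversal3 c l u v x :
    l <= 3 -> (forall e, 1 <= c e <= 3) -> extends_stars c 3 (5 * l + 5) ->
    uniq [:: u.1; v.1; x.1] ->
  exists T : 'I_l -> sgraph V,
    (forall i, rainbow_Stree (Krn r n) c [set y in [:: u; v; x]] (T i)) /\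
    internally_disjoint [set y in [:: u; v; x]] T.
Proof.
move=> l_le3 c_le3 ext uvx1.
pose P (i : nat) (e : {set V}) :=
  [\/ i = 0 /\ e = [set u; v],
      i = 1 /\ e = [set v; x] |
      i = 2 /\ e = [set x; u]].
have neq_uvx : [/\ u != v, v != x & x != u].
  move: uvx1; rewrite /= !inE negb_or andbT => /andP[/andP[uv ux] vx].
  by split; [move: uv|move: vx|move: ux; rewrite eq_sym];
    apply: contraNneq => ->.
apply: (@greedy_internally_disjoint _ _ _ _ _ 5 P).
  have edge_neq a b d : [/\ a != b, b != d & d != a] ->
      [set a; b] <> [set b; d] :> {set V}.
    case=> ab bd da eq_e; have : d \in [set a; b] by rewrite eq_e set22.
    by rewrite !inE (negPf da) eq_sym (negPf bd).
  case: neq_uvx => uv vx xu i j e.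
  have E1 := @edge_neq u v x (And3 uv vx xu).
  have E2 := @edge_neq v x u (And3 vx xu uv).
  have E3 := @edge_neq x u v (And3 xu uv vx).
  by case=> -[-> ->]; case=> -[-> eq_e] //;
    first [by case: E1 | by case: E2 | by case: E3].
have path a b d F : uniq [:: a.1; b.1; d.1] -> #|F| <= 5 * l -> exists T,
    [/\ rainbow_Stree (Krn r n) c [set y in [:: a; b; d]] T, #|vertices T| <= 5,
        vertices T :&: F \subset [set y in [:: a; b; d]] &
        forall e, e \in edges T -> e \subset [set y in [:: a; b; d]] ->
          e = [set a; b]].
  move=> abd1 leF.
  have abd : uniq [:: a; b; d] by apply: (@map_uniq _ _ (fun y : V => y.1)).
  (* [p] and [q] are the two colors different from that of the edge [ab]; they go to [bw] and
     [wd]. *)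
  have [p [q [pq_le3 pq_uniq]]] : exists p q,
      all (fun j => 1 <= j <= 3) [:: p; p; q] /\ uniq [:: q; p; c [set a; b]].
    have := c_le3 [set a; b]; case: (c _) => [|[|[|[|m]]]] // _.
    - by exists 2, 3.
    - by exists 1, 3.
    - by exists 1, 2.
  (* The vertex [a] is forbidden because [w] is sought in its class; the first [p] colors the
     non-edge [aw]. *)
  have [|w [wa wF _ cb cd]] :=
    ext a b d a.1 p p q (a |: F) abd pq_le3.
    by apply: leq_trans (leq_card_setU _ _) _; rewrite cards1; lia.
  move: wF; rewrite !inE negb_or => /andP[neq_wa wF].
  move: (abd1); rewrite /= !inE negb_or andbT => /andP[/andP[ab1 ad1] bd1].
  have neq_wb : w != b by apply: contraNneq ab1 => <-; rewrite wa.
  have neq_wd : w != d by apply: contraNneq ad1 => <-; rewrite wa.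
  have wS : w \notin [:: a; b; d].
    by rewrite !inE (negPf neq_wa) (negPf neq_wb) (negPf neq_wd).
  pose ps := [:: (d, w); (w, b); (a, b)].
  have [||||T [rT vT eT]] :=
    @grown_rainbow_Stree r n c [set y in [:: a; b; d]] b ps.
  - move: abd; rewrite /ps /= !inE !eqxx !negb_or !orbT !andbT neq_wb neq_wa
      (eq_sym d w) neq_wd.
    by rewrite (eq_sym d b) (eq_sym d a) => /andP[/andP[-> ->] ->].
  - by rewrite /= wa ab1 eq_sym ad1.
  - by rewrite /= cd (setUC [set w]) cb.
  - by apply/subsetP => y; rewrite !inE => /or3P[]->; rewrite ?orbT.
  exists T; split=> //.
  - rewrite vT cardsE; exact: leq_trans (card_size _) _.
  - apply/subsetP => y; rewrite vT !inE => /andP[/or4P[]];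
      try by move=> ->; rewrite ?orbT.
    by move/eqP->; rewrite (negPf wF).
  move=> e; rewrite eT inE => /mapP[p' pps ->];
    rewrite subUset !sub1set inE [_ \in [set _ in _]]inE.
  by move: pps; rewrite /ps !inE => /or3P[]/eqP-> //=;
    move: wS; rewrite !inE => /negPf->; rewrite ?andbF.
move=> i F lt_il leF.
have rotS : [set y in [:: u; v; x]] = [set y in [:: v; x; u]].
  by apply/setP => y; rewrite !inE orbC -orbA.
have rotS' : [set y in [:: u; v; x]] = [set y in [:: x; u; v]].
  by apply/setP => y; rewrite !inE orbA orbC.
have vxu1 : uniq [:: v.1; x.1; u.1].
  by rewrite -(rot_uniq 2).
have xuv1 : uniq [:: x.1; u.1; v.1].
  by rewrite -(rot_uniq 1).
case: i lt_il => [|[|[|i]]] lt_il; last lia.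
- have [T [? ? ? ?]] := path u v x F uvx1 leF; exists T; split=> // e eT eS.
  by constructor 1; auto.
- rewrite rotS; have [T [? ? ? ?]] := path v x u F vxu1 leF; exists T;
    split=> // e eT eS.
  by constructor 2; auto.
- rewrite rotS'; have [T [? ? ? ?]] := path x u v F xuv1 leF; exists T;
    split=> // e eT eS.
  by constructor 3; auto.
Qed.

Lemma extendable_transversal4 c l u v x :
    extends_stars c 4 (5 * l + 5) -> uniq [:: u.1; v.1; x.1] ->
  exists T : 'I_l -> sgraph V,
    (forall i, rainbow_Stree (Krn r n) c [set y in [:: u; v; x]] (T i)) /\
    internally_disjoint [set y in [:: u; v; x]] T.
Proof.
move=> ext uvx1.
have uvx : uniq [:: u; v; x] by apply: (@map_uniq _ _ (fun y : V => y.1)).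
apply: (@greedy_internally_disjoint _ _ _ _ _ 5 (fun _ _ => False)) => //.
move=> _ F _ leF; pose S := [set y in [:: u; v; x]].
have leSF : #|S :|: F| <= 5 * l + 5.
  apply: leq_trans (leq_card_setU _ _) _; rewrite addnC leq_add //.
  by rewrite cardsE (leq_trans (card_size _)).
move: (uvx1); rewrite /= !inE negb_or andbT => /andP[/andP[uv1 ux1] vx1].
(* The first color 1 falls on the non-edge [uw]; the tree uses color 1 on [wv] and color 2 on
   [wx]. *)
have [||w [wu wF _ cv cx]] := ext u v x u.1 1 1 2 (S :|: F) uvx; [by []|by []|].
move: wF; rewrite in_setU negb_or => /andP[wS wF].
move: (wS); rewrite !inE !negb_or => /and3P[neq_wu neq_wv neq_wx].
have uwx : uniq [:: u; w; x].
  by rewrite /= !inE negb_or (eq_sym u w) neq_wu neq_wx !andbT;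
    apply: contraNneq ux1 => ->.
(* Color 3 goes to [uw'] and color 4 to [ww']; the vertex [x] only fills the third place of the
   star. *)
have [||w' [wv' wF' cu cw _]] := ext u w x v.1 3 4 4 (S :|: F) uwx;
  [by []|by []|].
move: wF'; rewrite in_setU negb_or => /andP[wS' wF'].
move: (wS'); rewrite !inE !negb_or => /and3P[neq_wu' neq_wv' neq_wx'].
have neq_ww' : w' != w by apply: contraNneq uv1 => eq_w; rewrite -wu -wv' eq_w.
pose ps := [:: (u, w'); (w', w); (v, w); (x, w)].
have [||||T [rT vT eT]] := @grown_rainbow_Stree r n c S w ps.
- move: uvx; rewrite /ps /= !inE !eqxx !negb_or !orbT !andbT.
  rewrite !(eq_sym u) !(eq_sym v) !(eq_sym x) neq_wu neq_wv neq_wx neq_wu'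
    neq_ww'.
  by rewrite neq_wv' neq_wx' => /andP[/andP[-> ->] ->].
- by rewrite /= wv' wu uv1 (eq_sym v.1) uv1 (eq_sym x.1) ux1.
- by rewrite /= cu (setUC [set w']) cw cv cx.
- by apply/subsetP => y; rewrite !inE => /or3P[]->; rewrite ?orbT.
exists T; split=> //.
- rewrite vT cardsE; exact: leq_trans (card_size _) _.
- apply/subsetP => y; rewrite vT !inE => /andP[/or4P[|||/orP[]]];
    try by move=> ->; rewrite ?orbT.
  + by move/eqP->; rewrite (negPf wF).
  + by move/eqP->; rewrite (negPf wF').
move=> e; rewrite eT inE => /mapP[p' pps ->];
  rewrite subUset !sub1set => /andP[_].
by move: pps; rewrite /ps !inE => /or4P[]/eqP-> /=; apply/negP; move: wS wS';
  rewrite !inE.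
Qed.

End Extendable.

Lemma exists_extends_stars (r t L : nat) : 0 < t ->
  exists N, forall n, N <= n -> exists c : {set 'I_r * 'I_n} -> nat,
    (forall e, 1 <= c e <= t) /\ extends_stars c t L.
Proof.
move=> t_gt0; have [N HN] := exists_star_coloring r 3 L t_gt0.
exists N => n /HN[c [c_le ext]]; exists c; split=> // u v x k p q s F us ps leF.
have [w [wk wF pat]] := ext [tuple u; v; x] [tuple p; q; s] k F us ps leF.
exists w; split=> //.
- exact: (pat ord0).
- exact: (pat (Ordinal (isT : 1 < 3))).
- exact: (pat (Ordinal (isT : 2 < 3))).
Qed.

Lemma Krn_rainbow_colorable (r n l t : nat) (c : {set 'I_r * 'I_n} -> nat) :
    3 <= r -> 3 <= t -> (r = 3 -> t = 4 \/ l <= 3 /\ t = 3) ->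
    (forall e, 1 <= c e <= t) -> extends_stars c t (5 * l + 5) ->
  rainbow_colorable (Krn r n) 3 l t.
Proof.
move=> r_ge3 t_ge3 ht c_le ext; exists c; split=> [e _|S _ cardS];
  first exact: c_le.
have: uniq (enum S) by apply: enum_uniq.
have: size (enum S) = 3 by rewrite -cardE.
have: S = [set y in enum S] by apply/setP => y; rewrite inE mem_enum.
case: (enum S) => [|u [|v [|x [|? ?]]]] // -> _ uvx.
have [/existsP[k kS]|no_k] := boolP [exists k, k \notin [:: u.1; v.1; x.1]].
  exact: extendable_outer_class t_ge3 ext uvx kS.
(* If [S] meets all classes, then there are at most three of them, so [r = 3] and [S] is a
   transversal. *)
have sub : 'I_r \subset [:: u.1; v.1; x.1].
  by apply/subsetP => k _; move: no_k; rewrite negb_exists => /forallP/(_ k);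
    rewrite negbK.
have := subset_leq_card sub; rewrite card_ord => le_r.
have size_le := card_size [:: u.1; v.1; x.1].
have r3 : r = 3 by apply/eqP; rewrite eqn_leq r_ge3 (leq_trans le_r size_le).
have uvx1 : uniq [:: u.1; v.1; x.1].
  by apply/card_uniqP/eqP; rewrite eqn_leq size_le /= -{1}r3 le_r.
have [t4|[l3 t3]] := ht r3.
  by rewrite t4 in ext; apply: extendable_transversal4 ext uvx1.
by rewrite t3 in ext c_le; apply: extendable_transversal3 ext uvx1.
Qed.

(** * Lower bounds on the number of colors *)

Lemma set2_eq_neq (V : finType) (s q s' p : V) :
  [set s; q] = [set s'; p] -> s != p -> s = s' /\ q = p.
Proof.
move=> eq_e neq_sp; have /set2P[eq_s|eq_s] : s \in [set s'; p].
- by rewrite -eq_e set21.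
- split=> //; have /set2P[eq_q|//] : q \in [set s'; p] by rewrite -eq_e set22.
  have : p \in [set s; q] by rewrite eq_e set22.
  by rewrite eq_q -eq_s setUid => /set1P eq_p; rewrite eq_p eqxx in neq_sp.
by rewrite eq_s eqxx in neq_sp.
Qed.

Section LowerBounds.
Variable V : finType.
Implicit Types (G T : sgraph V) (c : {set V} -> nat).

Lemma card_rainbow_edges G T c t :
  edge_coloring G t c -> subgraph T G -> rainbow c T -> #|edges T| <= t.
Proof.
move=> col [_ /subsetP sub] rb.
rewrite cardE -(size_map c) -(size_iota 1 t); apply: uniq_leq_size.
  rewrite map_inj_in_uniq ?enum_uniq // => e f; rewrite !mem_enum; exact: rb.
move=> _ /mapP[e + ->]; rewrite mem_enum mem_iota add1n ltnS => /sub;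
  exact: col.
Qed.

(** Connectedness gives each of the three vertices an edge of [T], and by independence no edge
    serves two of them. *)
Lemma independent_triple_spokes T u v x :
    connected T -> uniq [:: u; v; x] ->
    {subset [:: u; v; x] <= vertices T} ->
    {in [:: u; v; x] &, forall y z, ~~ adj T y z} ->
  exists a b d, all (fun p => adj T p.1 p.2) [:: (u, a); (v, b); (x, d)] /\
    uniq [:: [set u; a]; [set v; b]; [set x; d]].
Proof.
move=> conn uvx sub indep.
move: (uvx); rewrite /= !inE negb_or andbT => /andP[/andP[uv ux] vx].
have uT : u \in vertices T by rewrite sub ?inE ?eqxx.
have vT : v \in vertices T by rewrite sub ?inE ?eqxx ?orbT.
have xT : x \in vertices T by rewrite sub ?inE ?eqxx ?orbT.
have [a ua] := connected_incident conn uT vT uv.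
have [b vb] := connected_incident conn vT xT vx.
have [d xd] : exists d, adj T x d.
  by apply: (connected_incident conn xT uT); rewrite eq_sym.
exists a, b, d; split; first by rewrite /= ua vb xd.
have neq y y' z z' : y \in [:: u; v; x] -> y' \in [:: u; v; x] -> y != y' ->
    adj T y' z' -> [set y; z] != [set y'; z'].
  move=> yS yS' neq_y adj'; apply: contraTneq adj' => eq_e.
  have [eq_yz|neq_yz] := eqVneq y z'; first by rewrite -eq_yz indep.
  by have [eq_y] := set2_eq_neq eq_e neq_yz; rewrite eq_y eqxx in neq_y.
by rewrite /= !inE negb_or !neq // ?inE ?eqxx ?orbT.
Qed.

End LowerBounds.

Lemma Krn_colors_ge3 r n l t :
  0 < r -> 2 < n -> 0 < l -> rainbow_colorable (Krn r n) 3 l t -> 2 < t.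
Proof.
move=> r_gt0 n_gt2 l_gt0 [c [col trees]].
pose f j : 'I_r * 'I_n := (Ordinal r_gt0, insubd (Ordinal n_gt2) j).
have uf : uniq [:: f 0; f 1; f 2].
  have neq i j : i < 3 -> j < 3 -> i != j -> f i != f j.
    move=> lti ltj; apply: contraNneq => -[/(congr1 val)].
    by rewrite !val_insubd !ifT ?(leq_trans _ n_gt2) // => ->.
  by rewrite /= !inE negb_or !neq.
have [||T [/(_ (Ordinal l_gt0)) [subT [conn _] S_T rb] _]] :=
  trees [set y in [:: f 0; f 1; f 2]]; first exact: subsetT.
  by rewrite cardsE; apply/card_uniqP.
set T0 := T _ in subT conn S_T rb.
have sub : {subset [:: f 0; f 1; f 2] <= vertices T0}.
  by move=> y yS; apply: (subsetP S_T); rewrite in_set.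
have [|a [b [d [/allP adjs ue]]]] := independent_triple_spokes conn uf sub.
  move=> y z yS zS; apply/negP => /(subsetP subT.2); rewrite mem_Krn_edges.
  by move: yS zS; rewrite !inE => /or3P[]/eqP-> /or3P[]/eqP->; rewrite eqxx.
apply: leq_trans (card_rainbow_edges col subT rb).
rewrite (_ : 3 = size [:: [set f 0; a]; [set f 1; b]; [set f 2; d]]) // cardE.
apply: uniq_leq_size => // e; rewrite mem_enum !inE.
by case/or3P=> /eqP->; [apply: (adjs (f 0, a)) | apply: (adjs (f 1, b)) |
  apply: (adjs (f 2, d))]; rewrite !inE eqxx ?orbT.
Qed.

(* Three edges cannot join a transversal of the three classes without using an
   edge inside it: they would have to form a star, whose center has no class. *)
Lemma transversal_tree_edge n (T : sgraph ('I_3 * 'I_n)%type) u v x :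
    subgraph T (Krn 3 n) -> connected T -> #|edges T| <= 3 ->
    uniq [:: u.1; v.1; x.1] -> {subset [:: u; v; x] <= vertices T} ->
  [|| adj T u v, adj T v x | adj T x u].
Proof.
move=> subT conn cardT uvx1 sub; apply: contraT => no_edge.
pose S := [:: u; v; x].
have uvx : uniq S by apply: (@map_uniq _ _ (fun y : 'I_3 * 'I_n => y.1)).
have adj_class y z : adj T y z -> y.1 != z.1.
  by move/(subsetP subT.2); rewrite mem_Krn_edges.
have indep : {in S &, forall y z, ~~ adj T y z}.
  have irr y : ~~ adj T y y by apply/negP => /adj_neq; rewrite eqxx.
  move: no_edge; rewrite !negb_or => /and3P[uv vx xu].
  move=> y z; rewrite !inE => /or3P[]/eqP-> /or3P[]/eqP-> //;
    by rewrite adj_sym.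
have [a [b [d [adjs ue]]]] := independent_triple_spokes conn uvx sub indep.
set ps := [:: (u, a); (v, b); (x, d)] in adjs.
have ps_S p : p \in ps -> p.1 \in S by exact: (map_f (fun q => q.1)).
have ps_out p : p \in ps -> p.2 \notin S.
  move=> pps; apply/negP => pS; have /negP := indep _ _ (ps_S _ pps) pS.
  by apply; exact: (allP adjs).
(* The three spokes are distinct and [T] has at most three edges, so they are all of its edges. *)
have edgesE y z : adj T y z ->
    exists2 p, p \in ps & [set y; z] = [set p.1; p.2].
  have sub_e : {subset [seq [set p.1; p.2] | p <- ps] <= enum (edges T)}.
    by move=> _ /mapP[p /(allP adjs) pT ->]; rewrite mem_enum.
  have [|_ eq_e] :=
    uniq_min_size (ue : uniq [seq [set p.1; p.2] | p <- ps]) sub_e.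
    by rewrite -cardE.
  move=> yz; apply/mapP; rewrite eq_e mem_enum; exact: yz.
have adj_S y z : y \in S -> adj T y z -> (y, z) \in ps.
  move=> yS /edgesE[[s p] sps /set2_eq_neq[]]; last by move=> -> ->.
  by apply: contraNneq (ps_out _ sps) => <-.
have a_out : a \notin S by apply: (ps_out (u, a)); rewrite inE eqxx.
have adj_a y : adj T y a -> y \in S.
  rewrite adj_sym => /edgesE[[s p] sps]; rewrite [RHS]setUC => /set2_eq_neq[].
    by apply: contraNneq a_out => ->; apply: (ps_S _ sps).
  by move=> _ ->; apply: (ps_S _ sps).
have ua : adj T u a by have /and4P[] := adjs.
(* A neighbor of [a] lies in [S] and has a single spoke, which leads to [a]. So [a] and its
   neighbors are closed under adjacency and hence contain every vertex of [T]. *)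
pose Z := [pred y | (y == a) || adj T y a].
have closedZ : closed (adj T) Z.
  apply: (intro_closed (sym_connect_sym (@adj_sym _ T))) => y z yz.
  rewrite !inE; case: eqP => [<- _|_ /= ya]; first by rewrite adj_sym yz orbT.
  have yS := adj_a _ ya.
  have [] := map_uniq_inj_in (uvx : uniq (map (fun p => p.1) ps))
    (adj_S _ _ yS yz) (adj_S _ _ yS ya) erefl.
  by move=> ->; rewrite eqxx.
(* The transversal meets all three classes, so some [s] shares the class of [a]; yet [s] would have
   to be adjacent to [a]. *)
have [s sS s_a] : exists2 s, s \in S & a.1 = s.1.
  have [||_ all_classes] := @uniq_min_size _ _ (enum 'I_3) uvx1.
  - by move=> k _; rewrite mem_enum.
  - by rewrite size_enum_ord.
  by apply/(mapP (f := fun y : 'I_3 * 'I_n => y.1));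
    rewrite all_classes mem_enum.
have sZ : s \in Z.
  rewrite -(closed_connect closedZ (conn.2 u s _ _)) ?inE ?ua ?orbT //.
    by apply: sub; rewrite inE eqxx.
  exact: sub.
move: sZ; rewrite inE => /orP[/eqP eq_s|/adj_class]; last by rewrite s_a eqxx.
by rewrite eq_s (negPf a_out) in sS.
Qed.

Lemma K3n_colors_ge4 n l t :
  0 < n -> 3 < l -> rainbow_colorable (Krn 3 n) 3 l t -> 3 < t.
Proof.
move=> n_gt0 l_gt3 [c [col trees]]; rewrite ltnNge; apply/negP => t_le3.
pose f j : 'I_3 * 'I_n := (inord j, Ordinal n_gt0).
have uf1 : uniq [:: (f 0).1; (f 1).1; (f 2).1].
  by rewrite /= !inE -!val_eqE /= !inordK.
have uf : uniq [:: f 0; f 1; f 2].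
  by apply: (@map_uniq _ _ (fun y : 'I_3 * 'I_n => y.1)).
have [||T [rT disj]] := trees [set y in [:: f 0; f 1; f 2]];
  first exact: subsetT.
  by rewrite cardsE; apply/card_uniqP.
pose es := [:: [set f 0; f 1]; [set f 1; f 2]; [set f 2; f 0]].
have has_es i : has (mem (edges (T i))) es.
  have [subT [conn _] S_T rb] := rT i.
  rewrite /= orbF; apply: transversal_tree_edge => //.
    exact: leq_trans (card_rainbow_edges col subT rb) t_le3.
  by move=> y yS; apply: (subsetP S_T); rewrite in_set.
(* [h i] is an edge inside the transversal used by the [i]-th tree. Edge-disjointness makes [h]
   injective into a list of three edges. *)
pose h i := nth set0 es (find (mem (edges (T i))) es).
have h_T i : h i \in edges (T i) by apply: (nth_find set0 (has_es i)).
have inj_h : injective h.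
  move=> i j eq_h; apply/eqP; apply: contraT => /disj[/setP/(_ (h i)) + _].
  by rewrite !inE h_T eq_h h_T.
have: l <= size es; last by rewrite leqNgt l_gt3.
rewrite -[leqLHS]size_enum_ord -(size_map h); apply: uniq_leq_size.
  by rewrite map_inj_uniq // enum_uniq.
by move=> _ /mapP[i _ ->]; rewrite mem_nth // -has_find.
Qed.

Theorem theorem3p3 (l r : nat) (hl : 0 < l) (hr : 3 <= r) :
  exists N : nat, 0 < N /\
    forall n : nat, N <= n ->
      is_rainbow_index (Krn r n) 3 l
        (if r == 3 then (if l <= 3 then 3 else 4) else 3).
Proof.
set t := if r == 3 then _ else _.
have t_ge3 : 3 <= t by rewrite /t; do 2?case: ifP.
(* Up to [5 * l] forbidden vertices come from trees already chosen; the other 5 leave room for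
   forbidding vertices of [S]. *)
have [N HN] := exists_extends_stars r (5 * l + 5) (ltnW (ltnW t_ge3)).
(* The lower bound needs three vertices in one class, hence [n >= 3]. *)
exists (maxn N 3); split=> [|n]; first by rewrite leq_max orbT.
rewrite geq_max => /andP[/HN[c [c_le ext]] n_ge3]; split.
  apply: (Krn_rainbow_colorable hr t_ge3 _ c_le ext) => r3.
  by rewrite /t r3 eqxx; case: (leqP l 3) => ?; [right | left].
move=> t' col.
have t'_ge3 : 2 < t' := Krn_colors_ge3 (ltnW (ltnW hr)) n_ge3 hl col.
rewrite /t; case: eqP => // r3; case: (leqP l 3) => // l_gt3.
by rewrite r3 in col; apply: K3n_colors_ge4 (ltnW (ltnW n_ge3)) l_gt3 col.
Qed.
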